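(* Let $f:[a,b]\to\mathbb{R}$ be a continuous $\Phi$-H\''older function, where $\Phi$ is superadditive. Then for any even number $n\in\mathbb{N}$, $$\max\{f(a),f(b)\}-\frac{1}{2}\Phi(b-a)\leq\frac{1}{b-a}\mathcal{S}_{n}(f)\leq\min\{f(a),f(b)\}+\frac{1}{2}\Phi(b-a).$$
   Context: Let $a<b$ be real numbers. $\mathbb{N}$ denotes the set of positive integers and $\mathbb{R}_+$ the set of nonnegative reals. $\Phi:[0,b-a]\to\mathbb{R}_+$ is a function (called the error function); it is superadditive if $\Phi(x)+\Phi(y)\leq\Phi(x+y)$ whenever $x$, $y$ and $x+y$ belong to $[0,b-a]$. A function $f:[a,b]\to\mathbb{R}$ is $\Phi$-monotone if $f(x)\leq f(y)+\Phi(y-x)$ for all $x,y\in[a,b]$ with $x<y$; it is $\Phi$-H\''older if both $f$ and $-f$ are $\Phi$-monotone, i.e. $|f(x)-f(y)|\leq\Phi(|y-x|)$ for all $x,y\in[a,b]$. For $n\in\mathbb{N}$ put $x_i=a+\frac{(b-a)i}{n}$, $i=0,1,\ldots,n$. For even $n\in\mathbb{N}$, Simpson's rule is $$\mathcal{S}_{n}(f)=\frac{b-a}{3n}\Big[f(x_0)+2\sum_{i=1}^{(n/2)-1}f(x_{2i})+4\sum_{i=1}^{n/2}f(x_{2i-1})+f(x_n)\Big].$$ *)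

(* Defs.v *)
From HB Require Import structures.
From mathcomp Require Import all_boot all_order all_algebra.
From mathcomp Require Import all_classical all_reals all_analysis.

Set Implicit Arguments.
Unset Strict Implicit.
Unset Printing Implicit Defensive.

Import Order.TTheory GRing.Theory Num.Theory.
Import numFieldNormedType.Exports.

Local Open Scope classical_set_scope.
Local Open Scope ring_scope.

(* Functions on an interval are total functions R -> R, constrained only on    *)
(* that interval: below, Phi is only considered on [0, c] (with c = b - a) and *)
(* f only on [a, b].                                                           *)

Definition error_function (R : realType) (c : R) (Phi : R -> R) : Prop :=
  forall x, x \in `[0, c] -> 0 <= Phi x.

Definition superadditive (R : realType) (c : R) (Phi : R -> R) : Prop :=
  forall x y, x \in `[0, c] -> y \in `[0, c] -> x + y \in `[0, c] ->
    Phi x + Phi y <= Phi (x + y).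

Definition Phi_monotone (R : realType) (a b : R) (Phi f : R -> R) : Prop :=
  forall x y, x \in `[a, b] -> y \in `[a, b] -> x < y ->
    f x <= f y + Phi (y - x).

Definition Phi_holder (R : realType) (a b : R) (Phi f : R -> R) : Prop :=
  Phi_monotone a b Phi f /\ Phi_monotone a b Phi (fun x => - f x).

Definition node (R : realType) (a b : R) (n i : nat) : R :=
  a + (b - a) * i%:R / n%:R.

(* Only meaningful for n even and positive. *)
Definition simpson (R : realType) (a b : R) (n : nat) (f : R -> R) : R :=
  let x := node a b n in
  (b - a) / (3 * n%:R) *
    (f (x 0%N) + 2 * (\sum_(1 <= i < n./2) f (x (2 * i)%N))
     + 4 * (\sum_(1 <= i < (n./2).+1) f (x (2 * i - 1)%N)) + f (x n)).

(* Main.v *)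
Require Import Defs.
From HB Require Import structures.
From mathcomp Require Import all_boot all_order all_algebra.
From mathcomp Require Import all_classical all_reals all_analysis.
From mathcomp Require Import ring lra zify.

(** The normalised Simpson sum is an average of the values of [f] at the nodes
    whose weights are nonnegative, add up to 1, and are symmetric under the
    reflection of the interval about its midpoint. Such an average is at most
    [D / 2] as soon as [f x + f y <= D] for every pair of mirror nodes [x], [y]
    ([simpson_mean_le]): average the sum with its own reflection.

    If [c] is either endpoint, mirror points are at distances from [c] that add
    up to [b - a]. The Hoelder condition bounds [f x] and [f y] by [f c] plus the
    error at these distances, and superadditivity merges the two errors into
    [Phi (b - a)] ([phi_holder_pair]). So [D] can be [2 f c + Phi (b - a)], which
    is the upper estimate; the lower one is the same estimate for [- f]. *)

Import Order.TTheory GRing.Theory Num.Theory.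
Import numFieldNormedType.Exports.

Local Open Scope classical_set_scope.
Local Open Scope ring_scope.

(** Adding the sum to its own reversal pairs the terms that are bounded. *)
Lemma sum_nat_rev_le (R : realType) (m n : nat) (F : nat -> R) (D : R) :
  (forall i, (m <= i < n)%N -> F i + F (m + n - i.+1)%N <= D) ->
  \sum_(m <= i < n) F i <= (n - m)%:R * (D / 2).
Proof.
move=> FD.
have : \sum_(m <= i < n) F i + \sum_(m <= i < n) F i <= (n - m)%:R * D.
  rewrite {2}big_nat_rev -big_split /= mulr_natl -sumr_const_nat.
  exact: ler_sum_nat.
by lra.
Qed.

Lemma node_rev (R : realType) (a b : R) (n i : nat) : (0 < n)%N -> (i <= n)%N ->
  node a b n i + node a b n (n - i) = a + b.
Proof.
move=> n0 ni; rewrite /node natrB//; field.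
by rewrite pnatr_eq0 -lt0n.
Qed.

Lemma node_itv (R : realType) (a b : R) (n i : nat) : a < b -> (0 < n)%N ->
  (i <= n)%N -> node a b n i \in `[a, b].
Proof.
move=> ab n0 ni; rewrite in_itv /= /node -mulrA.
have q0 : 0 <= i%:R / n%:R :> R by rewrite divr_ge0.
have q1 : i%:R / n%:R <= 1 :> R.
  by rewrite ler_pdivrMr ?ltr0n// mul1r ler_nat.
by apply/andP; split; nra.
Qed.

Lemma simpson_meanE (R : realType) (a b : R) (n : nat) (f : R -> R) : a < b ->
  1 / (b - a) * simpson a b n f =
  (3 * n%:R)^-1 *
    (f (node a b n 0) + 2 * (\sum_(1 <= i < n./2) f (node a b n (2 * i)%N))
     + 4 * (\sum_(1 <= i < (n./2).+1) f (node a b n (2 * i - 1)%N))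
     + f (node a b n n)).
Proof.
move=> ab; have ba0 : b - a != 0 by rewrite subr_eq0 gt_eqF.
by rewrite /simpson !mulrA mul1r mulVf// mul1r.
Qed.

Lemma simpsonN (R : realType) (a b : R) (n : nat) (f : R -> R) :
  simpson a b n (fun x => - f x) = - simpson a b n f.
Proof. by rewrite /simpson /= !sumrN; ring. Qed.

(** The reflection of the nodes preserves their parity because [n] is even, so
    each of the two sums in Simpson's rule is bounded separately by pairing its
    terms. *)
Lemma simpson_mean_le (R : realType) (a b : R) (n : nat) (f : R -> R) (D : R) :
  a < b -> (0 < n)%N -> ~~ odd n ->
  (forall i, (i <= n)%N -> f (node a b n i) + f (node a b n (n - i)) <= D) ->
  1 / (b - a) * simpson a b n f <= D / 2.
Proof.
move=> ab n0 n_even fD; rewrite simpson_meanE//.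
have nE : n = (2 * n./2)%N by rewrite mul2n even_halfK.
have Deven : \sum_(1 <= i < n./2) f (node a b n (2 * i)%N)
    <= (n./2 - 1)%:R * (D / 2).
  apply: sum_nat_rev_le => i /andP[i1 im].
  have -> : (2 * (1 + n./2 - i.+1) = n - 2 * i)%N by lia.
  by apply: fD; lia.
have Dodd : \sum_(1 <= i < (n./2).+1) f (node a b n (2 * i - 1)%N)
    <= ((n./2).+1 - 1)%:R * (D / 2).
  apply: sum_nat_rev_le => i /andP[i1 im].
  have -> : (2 * (1 + (n./2).+1 - i.+1) - 1 = n - (2 * i - 1))%N by lia.
  by apply: fD; lia.
have Dend : f (node a b n 0) + f (node a b n n) <= D.
  by have := fD 0%N isT; rewrite subn0.
have half_gt0 : (0 < n./2)%N by lia.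
have nR : n%:R = 2 * (n./2)%:R :> R by rewrite {1}nE natrM.
have n_gt0 : (0 : R) < 3 * n%:R by rewrite mulr_gt0 ?ltr0n.
rewrite mulrC ler_pdivrMr// nR.
move: Deven Dodd; rewrite subSS subn0 natrB//.
(* The weights add up: with [m = n./2], 2 + 2 (m - 1) + 4 m = 3 n. *)
by lra.
Qed.

(** The case [x = y], about which monotonicity says nothing, is where the error
    function has to be nonnegative (at 0). *)
Lemma phi_holder_le (R : realType) (a b : R) (Phi f : R -> R) (x y : R) :
  error_function (b - a) Phi -> Phi_holder a b Phi f ->
  x \in `[a, b] -> y \in `[a, b] -> f x <= f y + Phi `|x - y|.
Proof.
move=> Phi0 [fmono fNmono] xab yab.
have [xy|yx|<-] := ltgtP x y.
- by rewrite distrC gtr0_norm ?subr_gt0//; exact: fmono.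
- rewrite gtr0_norm ?subr_gt0//.
  by have := fNmono _ _ yab xab yx; lra.
- rewrite subrr normr0 lerDl Phi0// in_itv /= lexx /=.
  by move: xab; rewrite in_itv /= => /andP[ax xb]; lra.
Qed.

Lemma phi_holderN (R : realType) (a b : R) (Phi f : R -> R) :
  Phi_holder a b Phi f -> Phi_holder a b Phi (fun x => - f x).
Proof.
move=> [fmono fNmono]; split=> // x y xab yab xy /=.
by rewrite !opprK; exact: fmono.
Qed.

Lemma phi_holder_pair (R : realType) (a b : R) (Phi f : R -> R) (c x y : R) :
  error_function (b - a) Phi -> superadditive (b - a) Phi ->
  Phi_holder a b Phi f ->
  c \in `[a, b] -> x \in `[a, b] -> y \in `[a, b] ->
  `|x - c| + `|y - c| = b - a ->
  f x + f y <= 2 * f c + Phi (b - a).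
Proof.
move=> Phi0 Phisup fH cab xab yab xyc.
have fx := phi_holder_le R a b Phi f x c Phi0 fH xab cab.
have fy := phi_holder_le R a b Phi f y c Phi0 fH yab cab.
have x0 := normr_ge0 (x - c); have y0 := normr_ge0 (y - c).
have : Phi `|x - c| + Phi `|y - c| <= Phi (b - a).
  by rewrite -xyc; apply: Phisup; rewrite in_itv /=; apply/andP; split; lra.
by lra.
Qed.

Lemma dist_endpoint_sum (R : realType) (a b c x y : R) :
  c = a \/ c = b -> x \in `[a, b] -> y \in `[a, b] -> x + y = a + b ->
  `|x - c| + `|y - c| = b - a.
Proof.
rewrite !in_itv /= => cE /andP[ax xb] /andP[ay yb] xy.
case: cE => ->.
- by rewrite !ger0_norm ?subr_ge0//; lra.
- by rewrite !ler0_norm ?subr_le0//; lra.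
Qed.

Lemma simpson_mean_le_endpoint (R : realType) (a b : R) (Phi f : R -> R)
    (n : nat) (c : R) :
  a < b -> error_function (b - a) Phi -> superadditive (b - a) Phi ->
  Phi_holder a b Phi f -> (0 < n)%N -> ~~ odd n -> c = a \/ c = b ->
  1 / (b - a) * simpson a b n f <= f c + 1 / 2 * Phi (b - a).
Proof.
move=> ab Phi0 Phisup fH n0 n_even cE.
have cab : c \in `[a, b].
  by case: cE => ->; rewrite in_itv /= lexx (ltW ab).
have -> : f c + 1 / 2 * Phi (b - a) = (2 * f c + Phi (b - a)) / 2 by field.
apply: simpson_mean_le => // i ni.
have xab := node_itv R a b n i ab n0 ni.
have yab := node_itv R a b n (n - i) ab n0 (leq_subr i n).
apply: (phi_holder_pair R a b Phi f c) => //.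
by apply: dist_endpoint_sum => //; exact: node_rev.
Qed.

Theorem corollary4 (R : realType) (a b : R) (Phi f : R -> R)
  (hab : a < b)
  (hPhi : error_function (b - a) Phi)
  (hsup : superadditive (b - a) Phi)
  (hcont : {within `[a, b], continuous f})
  (hf : Phi_holder a b Phi f)
  (n : nat) (hn0 : (0 < n)%N) (hn : ~~ odd n) :
  Num.max (f a) (f b) - 1 / 2 * Phi (b - a) <= 1 / (b - a) * simpson a b n f
  /\ 1 / (b - a) * simpson a b n f <= Num.min (f a) (f b) + 1 / 2 * Phi (b - a).
Proof.
have upper c (cE : c = a \/ c = b) :=
  simpson_mean_le_endpoint R a b Phi f n c hab hPhi hsup hf hn0 hn cE.
have lower c (cE : c = a \/ c = b) :=
  simpson_mean_le_endpoint R a b Phi (fun x => - f x) n c hab hPhi hsup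
    (phi_holderN R a b Phi f hf) hn0 hn cE.
have ua := upper a (or_introl erefl); have ub := upper b (or_intror erefl).
have := lower a (or_introl erefl); have := lower b (or_intror erefl).
rewrite simpsonN mulrN => lb la.
split.
- by rewrite lerBlDr ge_max; apply/andP; split; lra.
- by rewrite -lerBlDr le_min; apply/andP; split; lra.
Qed.
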